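(* Let $A$ be a commutative ring with identity, let $d\geq 1$ be an integer, and let $R=A[\mathbb{R}_{\geq 0}^d]$ be the semigroup ring of the additive semigroup $\mathbb{R}_{\geq 0}^d$ over $A$. Let $I\subseteq R$ be a monomial ideal. Then the following are equivalent: (i) $I$ is generated by pure powers of a subset of the variables $X_1,\ldots,X_d$; (ii) there exist $\underline{\alpha}\in\mathbb{R}_{\infty\geq 0}^d$ and $\underline{\varepsilon}\in\mathbb{Z}_2^d$ such that $I=J_{\underline{\alpha},\underline{\varepsilon}}$; and (iii) $I$ is m-irreducible.
   Context: $\mathbb{R}_{\geq 0}=\{r\in\mathbb{R}\mid r\geq 0\}$, $\mathbb{R}_{\infty\geq 0}=\mathbb{R}_{\geq 0}\cup\{\infty\}$, $\mathbb{R}_{\infty\geq 0}^d=(\mathbb{R}_{\infty\geq 0})^d$, $\mathbb{Z}_2=\{0,1\}$. The ring $R=A[\mathbb{R}_{\geq 0}^d]$ is thought of as the set of all polynomials in $X_1,\ldots,X_d$ with coefficients in $A$ and non-negative real exponents. A monomial is an element $\underline{X}^{\underline{r}}=X_1^{r_1}\cdots X_d^{r_d}$ with $\underline{r}=(r_1,\ldots,r_d)\in\mathbb{R}_{\geq 0}^d$. A monomial ideal of $R$ is an ideal generated by a (possibly empty, possibly infinite) set of monomials. A pure power is a monomial of the form $X_i^r$ with $1\leq i\leq d$ and $r\in\mathbb{R}_{\geq 0}$; a generating set of pure powers may be empty (giving the zero ideal) or infinite. A monomial ideal $I$ is m-irreducible if for all monomial ideals $J,K$ of $R$ with $I=J\cap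 K$, either $I=J$ or $I=K$. For $\varepsilon\in\mathbb{Z}_2$ and $r,\alpha\in\mathbb{R}$, write $r\geq_\varepsilon\alpha$ to mean $r\geq\alpha$ if $\varepsilon=0$ and $r>\alpha$ if $\varepsilon=1$; also $s\geq_\varepsilon\infty$ means $s=\infty$. By convention $X_i^\infty=0$. For $\underline{\alpha}=(\alpha_1,\ldots,\alpha_d)\in\mathbb{R}_{\infty\geq 0}^d$ and $\underline{\varepsilon}=(\varepsilon_1,\ldots,\varepsilon_d)\in\mathbb{Z}_2^d$, set $J_{\underline{\alpha},\underline{\varepsilon}}=\left(\{X_i^{r_i}\mid i=1,\ldots,d\text{ and }r_i\geq_{\varepsilon_i}\alpha_i\}\right)R$ (so an index $i$ with $\alpha_i=\infty$ contributes no nonzero generator, and $J_{(\infty,\ldots,\infty),\underline{\varepsilon}}=0$). *)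

(* Defs.v *)
From HB Require Import structures.
From mathcomp Require Import all_boot all_order all_algebra.
(* monalg has to precede constructive_ereal: in the other order their notations
   clash *)
From mathcomp Require Import finmap monalg.
From mathcomp Require Import boolp classical_sets reals.
From mathcomp Require Import interval_inference constructive_ereal.

Set Implicit Arguments.
Unset Strict Implicit.
Unset Printing Implicit Defensive.

Import Order.TTheory GRing.Theory Num.Theory.
Local Open Scope classical_set_scope.
Local Open Scope ring_scope.

Definition expo (R : realType) (d : nat) := {ffun 'I_d -> {nonneg R}}.

HB.instance Definition _ (R : realType) d := Choice.on (expo R d).

Section ExpoMonoid.
Variables (R : realType) (d : nat).

Definition expo0 : expo R d := [ffun _ => 0%:nng].

Definition expoD (r s : expo R d) : expo R d :=
  [ffun i => ((r i)%:num + (s i)%:num)%:nng].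

Lemma expoDA : associative expoD.
Proof.
by move=> r s t; apply/ffunP => i; apply/val_inj; rewrite !ffunE /= addrA.
Qed.

Lemma expoDC : commutative expoD.
Proof.
by move=> r s; apply/ffunP => i; apply/val_inj; rewrite !ffunE /= addrC.
Qed.

Lemma expo0D : left_id expo0 expoD.
Proof.
by move=> r; apply/ffunP => i; apply/val_inj; rewrite !ffunE /= add0r.
Qed.

Lemma expoD0 : right_id expo0 expoD.
Proof. by move=> r; rewrite expoDC expo0D. Qed.

Lemma expoD_eq0 r s : expoD r s = expo0 -> r = expo0 /\ s = expo0.
Proof.
move=> /ffunP rs0.
have {}rs0 i : ((r i)%:num == 0) && ((s i)%:num == 0).
  rewrite -paddr_eq0 //; apply/eqP.
  by have /(congr1 val) := rs0 i; rewrite !ffunE.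
by split; apply/ffunP => i; apply/val_inj; rewrite ffunE /=;
  have /andP[/eqP ? /eqP ?] := rs0 i.
Qed.

HB.instance Definition _ := Choice_isMonomialDef.Build (expo R d)
  expoDA expo0D expoD0 expoD_eq0.
HB.instance Definition _ := MonomialDef_isConomialDef.Build (expo R d) expoDC.

End ExpoMonoid.

(* The ring structure of {malg A[K]} in monalg requires 1 != 0 in A. Here A may
   be the zero ring, so the same product is put on an alias of {malg A[K]}. *)
Definition sgring (R : realType) (A : comPzRingType) (d : nat) :=
  {malg A[expo R d]}.

HB.instance Definition _ (R : realType) (A : comPzRingType) d :=
  GRing.Zmodule.on (sgring R A d).

Section SemigroupRing.
Variables (R : realType) (A : comPzRingType) (d : nat).
Local Notation S := (sgring R A d).
Implicit Types f g h : S.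

Definition sgone : S := << 1 *g expo0 R d >>.

Definition sgmul f g : S :=
  \sum_(r <- msupp f) \sum_(s <- msupp g) << f@_r * g@_s *g expoD r s >>.

Lemma sgring_axioms :
  [/\ associative sgmul, commutative sgmul, left_id sgone sgmul
    & left_distributive sgmul +%R].
Proof.
have [A0 | A1] := eqVneq (1 : A) 0.
  have S0 f g : f = g.
    by apply/malgP => r; rewrite -[LHS]mul1r -[RHS]mul1r A0 !mul0r.
  by split=> [f g h|f g|f|f g h]; apply: S0.
pose nzA := GRing.PzSemiRing_isNonZero.Build A A1.
pose A' : comNzRingType := HB.pack A nzA.
split.
- exact: (@fgmulA (expo R d) A').
- exact: (@fgmulC (expo R d) A').
- exact: (@fgmul1g (expo R d) A').
- exact: (@fgmulgDl (expo R d) A').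
Qed.

Lemma sgmulA : associative sgmul. Proof. by case: sgring_axioms. Qed.
Lemma sgmulC : commutative sgmul. Proof. by case: sgring_axioms. Qed.
Lemma sgmul1 : left_id sgone sgmul. Proof. by case: sgring_axioms. Qed.
Lemma sgmulDl : left_distributive sgmul +%R.
Proof. by case: sgring_axioms. Qed.

HB.instance Definition _ := GRing.Zmodule_isComPzRing.Build S
  sgmulA sgmulC sgmul1 sgmulDl.

End SemigroupRing.

Section Ideals.
Variable S : comPzRingType.
Implicit Types I G : set S.

Definition is_ideal I : Prop :=
  [/\ I 0, forall f g, I f -> I g -> I (f + g)
    & forall f g, I g -> I (f * g)].

Definition ideal_gen G : set S := smallest is_ideal G.

End Ideals.

Section MonomialIdeals.
Variables (R : realType) (A : comPzRingType) (d : nat).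
Local Notation S := (sgring R A d).
Implicit Types (I J K G : set S) (r : expo R d) (i : 'I_d).

Definition monomial r : S := << 1 *g r >>.

Definition monomial_ideal I : Prop :=
  exists2 G, G `<=` range monomial & I = ideal_gen G.

Definition pure_power i (t : {nonneg R}) : S :=
  monomial [ffun j => if j == i then t else 0%:nng].

Definition m_irreducible I : Prop :=
  monomial_ideal I /\
  forall J K, monomial_ideal J -> monomial_ideal K ->
    I = J `&` K -> I = J \/ I = K.

(* T is the subset of the variables that may occur *)
Definition generated_by_pure_powers I : Prop :=
  exists (T : {set 'I_d}) (G : set S),
    (forall f, G f -> exists2 i, i \in T & exists t, f = pure_power i t) /\
    I = ideal_gen G.

(* X_i ^ s for s in [0, +oo], with the convention X_i ^ +oo = 0 *)
Definition ext_pure_power i (s : {nonneg \bar R}) : S :=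
  if s%:num == +oo%E then 0 else pure_power i (fine s%:num)%:nng.

Definition geq_eps (e : bool) (s a : \bar R) : Prop :=
  if a == +oo%E then s = +oo%E
  else if e then (a < s)%E else (a <= s)%E.

Definition Jideal (alpha : 'I_d -> {nonneg \bar R}) (eps : 'I_d -> bool) :
    set S :=
  ideal_gen [set f | exists i (s : {nonneg \bar R}),
    geq_eps (eps i) s%:num (alpha i)%:num /\ f = ext_pure_power i s].

End MonomialIdeals.

(* Main.v *)
Require Import Defs.
From mathcomp Require Import all_boot all_order all_algebra.
From mathcomp Require Import finmap monalg.
From mathcomp Require Import boolp classical_sets reals.
From mathcomp Require Import interval_inference constructive_ereal.

(** The lattice of monomials under divisibility decides everything. A monomial
    ideal is determined by the monomials it contains, so being m-irreducible
    amounts to a primality condition on monomials: an lcm of two monomials lies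
    in the ideal only if one of the two does ([m_irreducibleP]).

    - Unless A is the zero ring, [Jideal alpha eps] contains a monomial exactly
      when one of the exponents of the monomial passes its threshold. Each
      exponent of an lcm comes from one of the two monomials, so the ideal is
      lcm-prime ([Jideal_lcm_prime]); over the zero ring this is trivial.
    - Conversely a monomial is the lcm of the powers X_i ^ (r i), so an lcm-prime
      ideal contains, with each monomial, a pure power dividing it
      ([lcm_prime_pure_power]); hence its pure powers generate it.
    - If pure powers generate I, the threshold alpha i is the infimum of
      the exponents of the generators in X_i (+oo if there are none), and eps i
      says whether this infimum is missed ([threshold_exists]). *)

Set Implicit Arguments.
Unset Strict Implicit.
Unset Printing Implicit Defensive.

Import Order.TTheory GRing.Theory Num.Theory.

Section PurePowerIdeals.
Local Open Scope classical_set_scope.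
Local Open Scope ring_scope.

(** * Generated ideals *)

Section IdealGen.
Variable S : comPzRingType.
Implicit Types I G : set S.

Lemma ideal_gen_ideal G : is_ideal (ideal_gen G).
Proof.
split.
- by move=> I [[I0 _ _] _].
- move=> f g If Ig I HI; case: (HI) => -[_ ID _] _.
  by apply: ID; [apply: If|apply: Ig].
- by move=> f g Ig I HI; case: (HI) => -[_ _ IM] _; apply: IM; apply: Ig.
Qed.

Lemma sub_ideal_gen G : G `<=` ideal_gen G.
Proof. exact: sub_gen_smallest. Qed.

Lemma ideal_gen_sub I G : is_ideal I -> G `<=` I -> ideal_gen G `<=` I.
Proof. exact: smallest_sub. Qed.

Lemma ideal_gen_eq G G' : G `<=` ideal_gen G' -> G' `<=` ideal_gen G ->
  ideal_gen G = ideal_gen G'.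
Proof.
by move=> GG' G'G; apply/seteqP; split; apply: ideal_gen_sub => //;
  apply: ideal_gen_ideal.
Qed.

Lemma ideal_sum I (T : eqType) (s : seq T) (F : T -> S) : is_ideal I ->
  (forall x, x \in s -> I (F x)) -> I (\sum_(x <- s) F x).
Proof.
case=> I0 ID _ IF; rewrite big_seq.
by apply: (big_ind (fun f => I f)) => // x /IF.
Qed.

End IdealGen.

Section MonomialIdeals.
Variables (R : realType) (A : comPzRingType) (d : nat).
Local Notation S := (sgring R A d).
Local Notation E := (expo R d).
Local Notation mono := (@monomial R A d).
Implicit Types (I J K G : set S) (r s a b : E) (i j : 'I_d) (f g : S).

(** * Exponents under divisibility *)

Definition expo_le a r : Prop := forall i, (a i)%:num <= (r i)%:num.

Definition expo_lcm a b : E :=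
  [ffun i => (Num.max (a i)%:num (b i)%:num)%:nng].

Definition pure_expo i (t : {nonneg R}) : E :=
  [ffun j => if j == i then t else 0%:nng].

Definition expo_on (l : seq 'I_d) r : E :=
  [ffun i => if i \in l then r i else 0%:nng].

Lemma expo_le_trans a b r : expo_le a b -> expo_le b r -> expo_le a r.
Proof. by move=> ab br i; apply: le_trans (br i). Qed.

Lemma expo_leDr a r : expo_le a (expoD r a).
Proof. by move=> i; rewrite ffunE /= lerDr. Qed.

Lemma expo_le_exD a r : expo_le a r -> exists s, r = expoD s a.
Proof.
move=> ar; have ge0 i : 0 <= (r i)%:num - (a i)%:num by rewrite subr_ge0.
exists [ffun i => NngNum (ge0 i)].
by apply/ffunP => i; apply/val_inj; rewrite !ffunE /= subrK.
Qed.

Lemma expo_lelcml a b : expo_le a (expo_lcm a b).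
Proof. by move=> i; rewrite ffunE /= le_max lexx. Qed.

Lemma expo_lelcmr a b : expo_le b (expo_lcm a b).
Proof. by move=> i; rewrite ffunE /= le_max lexx orbT. Qed.

Lemma expo_lcm_le a b r : expo_le a r -> expo_le b r -> expo_le (expo_lcm a b) r.
Proof. by move=> ar br i; rewrite ffunE /= ge_max ar br. Qed.

Lemma pure_expo_le i (t : {nonneg R}) r :
  t%:num <= (r i)%:num -> expo_le (pure_expo i t) r.
Proof. by move=> tr j; rewrite ffunE; case: eqP => [->|_] //=. Qed.

(** * Monomials in an ideal *)

Lemma sgmulUU (c c' : A) r s :
  sgmul << c *g r >> << c' *g s >> = << c * c' *g expoD r s >> :> S.
Proof.
rewrite /sgmul !msuppU; case: eqVneq => [->|_].
  by rewrite big_seq_fset0 mul0r monalgU0.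
rewrite big_seq_fset1; case: eqVneq => [->|_].
  by rewrite big_seq_fset0 mulr0 monalgU0.
by rewrite big_seq_fset1 !mcoeffUU.
Qed.

Lemma ideal_term I (c : A) r : is_ideal I -> I (mono r) -> I << c *g r >>.
Proof.
case=> _ _ IM Ir.
have := IM << c *g expo0 R d >> _ Ir.
by rewrite [_ * _]sgmulUU mulr1 expo0D.
Qed.

Lemma ideal_mono_le I a r :
  is_ideal I -> expo_le a r -> I (mono a) -> I (mono r).
Proof.
move=> [_ _ IM] /expo_le_exD[s ->] Ia.
by have := IM (mono s) _ Ia; rewrite [_ * _]sgmulUU mulr1.
Qed.

Lemma ideal_supp I f : is_ideal I ->
  (forall r, r \in msupp f -> I (mono r)) -> I f.
Proof.
move=> idI If; rewrite [f]monalgE.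
apply: (@ideal_sum S I _ _ (fun r => << f@_r *g r >>) idI) => r /If.
exact: ideal_term.
Qed.

(** Monomial ideals have this form, with U closed under multiples. An ideal
    whose generators lie in such a set lies in it as a whole, which bounds the
    exponents that can occur in a generated ideal. *)
Definition supp_in (U : set E) : set S :=
  [set f | forall r, r \in msupp f -> U r].

Lemma supp_in_ideal (U : set E) : (forall a r, U a -> expo_le a r -> U r) ->
  is_ideal (supp_in U).
Proof.
move=> Uup.
have U0 : supp_in U 0 by move=> r; rewrite msupp0 in_fset0.
have UD f g : supp_in U f -> supp_in U g -> supp_in U (f + g).
  move=> Uf Ug r /(fsubsetP (msuppD_le _ _)).
  by rewrite in_fsetU => /orP[/Uf|/Ug].
split=> // f g Ug; rewrite [f * g]/(sgmul f g) /sgmul.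
rewrite big_seq; apply: (big_ind (supp_in U)) => // r _.
rewrite big_seq; apply: (big_ind (supp_in U)) => // s sg.
move=> t /(fsubsetP msuppU_le); rewrite in_fset1 => /eqP ->.
exact: Uup (Ug _ sg) (expo_leDr _ _).
Qed.

Lemma supp_in_mono (U : set E) r : supp_in U (mono r) -> mono r = 0 \/ U r.
Proof.
rewrite /supp_in /= msuppU; case: eqP => [e _|_ Ur]; last first.
  by right; apply: Ur; rewrite in_fset1.
by left; rewrite /monomial e monalgU0.
Qed.

Lemma ideal_gen_mono_supp G f r : G `<=` range mono -> ideal_gen G f ->
  r \in msupp f -> exists2 a, G (mono a) & expo_le a r.
Proof.
move=> Gm Gf rf; pose U := [set s | exists2 a, G (mono a) & expo_le a s].
have idU : is_ideal (supp_in U).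
  apply: supp_in_ideal => s t [a Ga /expo_le_trans le_a] /le_a.
  by exists a.
suff : ideal_gen G `<=` supp_in U by move/(_ f Gf r rf).
apply: ideal_gen_sub => // g Gg; have [a _ ga] := Gm g Gg.
move=> s; rewrite -ga => /(fsubsetP msuppU_le); rewrite in_fset1 => /eqP ->.
by exists a; rewrite ?ga.
Qed.

Lemma monomial_ideal_is_ideal I : monomial_ideal I -> is_ideal I.
Proof. by case=> G _ ->; apply: ideal_gen_ideal. Qed.

Lemma monomial_ideal_sub I J : monomial_ideal J -> is_ideal I ->
  (forall r, J (mono r) -> I (mono r)) -> J `<=` I.
Proof.
move=> [G Gm ->] idI JI; apply: ideal_gen_sub => // f Gf.
have [r _ fr] := Gm f Gf; rewrite -fr in Gf *.
by apply: JI; apply: sub_ideal_gen.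
Qed.

(** * m-irreducibility is primality for least common multiples *)

Definition lcm_prime I : Prop :=
  forall a b, I (mono (expo_lcm a b)) -> I (mono a) \/ I (mono b).

(** If I is the intersection of J and K and differs from both, then the lcm of
    a monomial in J outside I and one in K outside I refutes primality.
    Conversely, if the lcm of a and b is in I, then I is the intersection of
    I + (X^a) and I + (X^b). *)
Lemma m_irreducibleP I : monomial_ideal I -> m_irreducible I <-> lcm_prime I.
Proof.
move=> monoI; have idI := monomial_ideal_is_ideal monoI.
split=> [[_ irrI] a b Iab|primeI].
  have [G Gm IG] := monoI.
  pose adjoin c := ideal_gen (G `|` [set mono c]).
  have adjoinm c : G `|` [set mono c] `<=` range mono.
    by move=> f [/Gm //|->]; exists c.
  have adjoinM c : monomial_ideal (adjoin c) by exists (G `|` [set mono c]).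
  have adjoin_c c : adjoin c (mono c) by apply: sub_ideal_gen; right.
  have sub_adjoin c : I `<=` adjoin c.
    rewrite IG; apply: ideal_gen_sub; first exact: ideal_gen_ideal.
    by move=> f Gf; apply: sub_ideal_gen; left.
  have adjoin_supp c f r : adjoin c f -> r \in msupp f ->
      I (mono r) \/ expo_le c r.
    move=> cf /(ideal_gen_mono_supp (@adjoinm c) cf) [e].
    case=> [Ge er|ec er].
      left; apply: ideal_mono_le er _ => //.
      by rewrite IG; apply: sub_ideal_gen.
    (* distinct exponents give distinct monomials unless A is the zero ring *)
    have [A0|A1] := eqVneq (1 : A) 0.
      left; have -> : mono r = 0 by rewrite /monomial A0 monalgU0.
      by case: idI.
    right; suff <- : e = c by [].
    have : (mono e)@_e = (mono c)@_e by rewrite ec.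
    rewrite !mcoeffU eqxx; case: eqP => [-> //|_] /eqP.
    by rewrite /= (negPf A1).
  have [||] := irrI _ _ (adjoinM a) (adjoinM b); last 2 first.
  - by move=> ->; left.
  - by move=> ->; right.
  apply/seteqP; split=> [f If|f [fa fb]]; first by split; apply: sub_adjoin.
  apply: ideal_supp => // r rf.
  have [//|ar] := adjoin_supp _ _ _ fa rf.
  have [//|br] := adjoin_supp _ _ _ fb rf.
  by apply: ideal_mono_le Iab => //; apply: expo_lcm_le.
split=> // J K monoJ monoK IJK.
have idJ := monomial_ideal_is_ideal monoJ.
have idK := monomial_ideal_is_ideal monoK.
have [JI|nJI] := pselect (forall r, J (mono r) -> I (mono r)).
  left; apply/seteqP; split; last exact: monomial_ideal_sub.
  by rewrite IJK => f [].
have [KI|nKI] := pselect (forall r, K (mono r) -> I (mono r)).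
  right; apply/seteqP; split; last exact: monomial_ideal_sub.
  by rewrite IJK => f [].
move: nJI => /existsNP[a /not_implyP[Ja nIa]].
move: nKI => /existsNP[b /not_implyP[Kb nIb]].
have : I (mono (expo_lcm a b)).
  rewrite IJK; split.
    by apply: ideal_mono_le Ja => //; apply: expo_lelcml.
  by apply: ideal_mono_le Kb => //; apply: expo_lelcmr.
by move=> /primeI[].
Qed.

(** * Threshold ideals are lcm-prime *)

Section Threshold.
Variables (alpha : 'I_d -> {nonneg \bar R}) (eps : 'I_d -> bool).
Local Notation passes i x := (geq_eps (eps i) x%:E (alpha i)%:num).

Lemma passes_le i (x y : R) : x <= y -> passes i x -> passes i y.
Proof.
rewrite /geq_eps -lee_fin; case: ifP => [_ _ //|_].
by case: (eps i) => xy; [move=> /lt_le_trans|move=> /le_trans]; apply.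
Qed.

Lemma Jideal_mono_passes r : Jideal (A := A) alpha eps (mono r) ->
  mono r = 0 \/ exists i, passes i (r i)%:num.
Proof.
pose U := [set s : E | exists i, passes i (s i)%:num].
suff JU : Jideal (A := A) alpha eps `<=` supp_in U.
  by move=> /JU /supp_in_mono.
apply: ideal_gen_sub.
  by apply: supp_in_ideal => a s [i Ui] /(_ i) as_; exists i; apply: passes_le Ui.
move=> _ [i [s [si ->]]]; rewrite /ext_pure_power.
case: eqP => [_|sfin] t; first by rewrite msupp0 in_fset0.
move=> /(fsubsetP msuppU_le); rewrite in_fset1 => /eqP ->.
exists i; rewrite ffunE eqxx /= fineK //.
by rewrite ge0_fin_numE // lt_neqAle leey andbT; apply/eqP.
Qed.

Lemma passes_Jideal_mono i r :
  passes i (r i)%:num -> Jideal (A := A) alpha eps (mono r).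
Proof.
move=> ri; have idJ : is_ideal (Jideal (A := A) alpha eps).
  exact: ideal_gen_ideal.
apply: (ideal_mono_le idJ (pure_expo_le (lexx (r i)%:num))).
apply: sub_ideal_gen; exists i, ((r i)%:num%:E)%:nng%E; split=> //.
rewrite /ext_pure_power /= /pure_power /pure_expo; congr monomial.
by apply/ffunP => j; rewrite !ffunE; case: eqP => // _; apply/val_inj.
Qed.

Lemma Jideal_lcm_prime : lcm_prime (Jideal (A := A) alpha eps).
Proof.
move=> a b /Jideal_mono_passes[ab0|[i]].
  (* a monomial vanishes only if 1 = 0 in A *)
  left; suff -> : mono a = 0.
    by have [] : is_ideal (Jideal (A := A) alpha eps) by exact: ideal_gen_ideal.
  have /eqP := ab0; rewrite monalgU_eq0 => /eqP A0.
  by rewrite /monomial A0 monalgU0.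
rewrite ffunE /=; case: leP => _ pi.
  by right; apply: (passes_Jideal_mono pi).
by left; apply: (passes_Jideal_mono pi).
Qed.

End Threshold.

(** * Lcm-prime ideals are generated by pure powers *)

(** The induction adds the variables one at a time: the part of r supported on
    i :: l is the lcm of X_i ^ (r i) and the part supported on l. *)
Lemma lcm_prime_pure_power I r : (0 < d)%N -> is_ideal I -> lcm_prime I ->
  I (mono r) -> exists i, I (pure_power A i (r i)).
Proof.
move=> d_gt0 idI primeI.
have {1}-> : r = expo_on (enum 'I_d) r.
  by apply/ffunP => i; rewrite ffunE mem_enum.
elim: (enum 'I_d) => [I1|i l IHl].
  (* here 1 is in I, so any variable serves *)
  exists (Ordinal d_gt0); apply: ideal_mono_le I1 => // j.
  by rewrite ffunE in_nil /=.
suff -> : expo_on (i :: l) r = expo_lcm (pure_expo i (r i)) (expo_on l r).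
  by move=> /primeI[Ii|/IHl //]; exists i.
apply/ffunP => j; apply/val_inj; rewrite !ffunE inE /=.
case: eqP => [->|_] /=; first by case: ifP => _ /=; rewrite ?maxxx ?max_l.
by rewrite max_r.
Qed.

Lemma lcm_prime_generated I : (0 < d)%N -> monomial_ideal I -> lcm_prime I ->
  generated_by_pure_powers I.
Proof.
move=> d_gt0 monoI primeI; have idI := monomial_ideal_is_ideal monoI.
pose G := [set f | I f /\ exists i t, f = pure_power A i t].
exists [set: 'I_d]%SET, G; split=> [f [_ [i [t ->]]]|].
  by exists i; [rewrite finset.in_setT|exists t].
apply/seteqP; split; last by apply: ideal_gen_sub => // f [].
apply: (monomial_ideal_sub monoI (ideal_gen_ideal G)).
move=> r /(lcm_prime_pure_power d_gt0 idI primeI)[i Ii].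
apply: (ideal_mono_le (ideal_gen_ideal G) (pure_expo_le (lexx (r i)%:num))).
by apply: sub_ideal_gen; split=> //; exists i, (r i).
Qed.

(** * Ideals generated by pure powers are threshold ideals *)

(** With X the exponents of the generators in one variable, the two conclusions
    make the powers beyond the threshold and those with exponent in X generate
    the same ideal. They hold for alpha the infimum of X, because an exponent
    strictly above it is also above some element of X. *)
Lemma threshold_exists (X : set {nonneg R}) :
  exists (alpha : {nonneg \bar R}) (eps : bool),
    (forall t, X t -> geq_eps eps t%:num%:E alpha%:num) /\
    (forall x : R, geq_eps eps x%:E alpha%:num -> exists2 t, X t & t%:num <= x).
Proof.
have [[t0 Xt0]|X0] := pselect (exists t, X t); last first.
  exists (+oo%:nng)%E, false; split=> [t Xt|x].
    by case: X0; exists t.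
  by rewrite /geq_eps eqxx.
pose Y : set R := [set t%:num | t in X].
have Y0 : Y !=set0 by exists t0%:num, t0.
have lbY : lbound Y 0 by move=> _ [t _ <-].
have hasinf : has_inf Y by split=> //; exists 0.
have inf0 : 0 <= inf Y by apply: lb_le_inf.
have infY t : X t -> inf Y <= t%:num.
  by move=> Xt; apply: ge_inf; [exists 0|exists t].
exists (((NngNum inf0)%:num)%:E)%:nng%E, (~~ `[< Y (inf Y) >]); split=> [t Xt|x].
  rewrite /geq_eps /=; case: asboolP => /= nY; first by rewrite lee_fin infY.
  rewrite lte_fin lt_neqAle infY // andbT; apply/eqP => e.
  by apply: nY; rewrite e; exists t.
rewrite /geq_eps /=; case: asboolP => /= [[t Xt tinf]|_].
  by rewrite lee_fin -tinf; exists t.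
rewrite lte_fin -subr_gt0 => /inf_adherent /(_ hasinf)[_ [t Xt <-]].
by rewrite subrKC => /ltW; exists t.
Qed.

Lemma generated_Jideal I : generated_by_pure_powers I ->
  exists (alpha : 'I_d -> {nonneg \bar R}) (eps : 'I_d -> bool),
    I = Jideal alpha eps.
Proof.
move=> [T [G [GT ->]]].
pose X i : set {nonneg R} := [set t | G (pure_power A i t)].
have /boolp.choice[alpha] := fun i => threshold_exists (X i).
move=> /boolp.choice[eps Xthr]; exists alpha, eps.
apply: ideal_gen_eq => f.
  move=> Gf; have [i _ [t ft]] := GT f Gf; rewrite ft.
  have [Xi _] := Xthr i; apply: (@passes_Jideal_mono _ _ i).
  by rewrite ffunE eqxx; apply: Xi; rewrite /X /= -ft.
case=> i [s [si ->]]; rewrite /ext_pure_power.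
have idG := ideal_gen_ideal G.
case: eqP => [_|sfin]; first by case: idG.
have [_ /(_ (fine s%:num))] := Xthr i; rewrite fineK; last first.
  by rewrite ge0_fin_numE // lt_neqAle leey andbT; apply/eqP.
move=> /(_ si)[t Gt ts]; apply: ideal_mono_le (sub_ideal_gen Gt) => //.
by apply: pure_expo_le; rewrite ffunE eqxx.
Qed.

End MonomialIdeals.
End PurePowerIdeals.

Theorem theorem3p9 (R : realType) (A : comPzRingType) (d : nat)
    (d_ge1 : (1 <= d)%N) (I : set (sgring R A d))
    (monoI : monomial_ideal I) :
  (generated_by_pure_powers I <->
   exists (alpha : 'I_d -> {nonneg \bar R}) (eps : 'I_d -> bool),
     I = Jideal alpha eps) /\
  ((exists (alpha : 'I_d -> {nonneg \bar R}) (eps : 'I_d -> bool),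
     I = Jideal alpha eps) <->
   m_irreducible I).
Proof.
have threshold_irr : (exists (alpha : 'I_d -> {nonneg \bar R})
    (eps : 'I_d -> bool), I = Jideal alpha eps) -> m_irreducible I.
  move=> [alpha [eps IJ]]; apply/(m_irreducibleP monoI).
  by rewrite IJ; apply: Jideal_lcm_prime.
have irr_gen : m_irreducible I -> generated_by_pure_powers I.
  by move=> /(m_irreducibleP monoI); apply: lcm_prime_generated.
split; split.
- exact: generated_Jideal.
- by move=> /threshold_irr /irr_gen.
- exact: threshold_irr.
- by move=> /irr_gen /generated_Jideal.
Qed.
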